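(* Let $\mathcal{M}$ be an episodic finite-horizon MDP with finite state space $\mathcal{S}$, finite action space $\mathcal{A}$, horizon $H$, transitions $\{p_h\}_{h\in[H]}$ and initial state $s_1$. For any target function $c:[H]\times\mathcal{S}\times\mathcal{A}\to\mathbb{R}$ and any $\delta\in(0,1)$, the stopping time $\tau$ (number of episodes played) of any $\delta$-correct $c$-coverage algorithm satisfies $$\mathbb{E}[\tau]\ \ge\ (1-\delta)\,\varphi^\star(c),\qquad \varphi^\star(c)=\inf_{\rho\in\Omega}\ \max_{(h,s,a)\in\mathcal{X}}\frac{c_h(s,a)}{\rho_h(s,a)},\qquad \mathcal{X}:=\{(h,s,a):c_h(s,a)>0\}.$$
   Context: Interaction: in each episode $t=1,2,\dots$ the learner chooses (based on all past observations) a possibly stochastic policy $\pi^t=\{\pi^t_h\}_{h\in[H]}$, $\pi^t_h:\mathcal{S}\to\mathcal{P}(\mathcal{A})$ ($\mathcal P$ denotes the set of probability distributions), starts in $s_1^t=s_1$, and for each stage $h\in[H]$ draws $a_h^t\sim\pi_h^t(\cdot|s_h^t)$ and observes $s_{h+1}^t\sim p_h(\cdot|s_h^t,a_h^t)$. Let $n_h^t(s,a)=\sum_{j=1}^t\mathbf{1}(s_h^j=s,a_h^j=a)$. Let $\Pi^S$ be the set of all stochastic policies $\pi=\{\pi_h\}_{h\in[H]}$ with $\pi_h:\mathcal S\to\mathcal P(\mathcal A)$. For $\pi\in\Pi^S$, $p_h^\pi(s,a)=\mathbb{P}^\pi(s_h=s,a_h=a)$ is the probability that an episode played with $\pi$ visits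 $(s,a)$ at stage $h$, and $\Omega=\{p^\pi:\pi\in\Pi^S\}$. An algorithm is called $\delta$-correct $c$-coverage if, with probability at least $1-\delta$, it stops after interacting with $\mathcal{M}$ for $\tau$ episodes and returns a dataset of transitions with visitation counts satisfying $n_h^\tau(s,a)\ge c_h(s,a)$ for all $(h,s,a)$. Conventions: $x/0=+\infty$ for $x>0$; $\varphi^\star(c)=0$ if $\mathcal{X}=\emptyset$. *)

(* Defs.v *)
From mathcomp Require Import all_boot all_order all_algebra.
From mathcomp Require Import all_classical all_reals all_analysis.

Set Implicit Arguments.
Unset Strict Implicit.
Unset Printing Implicit Defensive.

Import Order.TTheory GRing.Theory Num.Theory.

Local Open Scope classical_set_scope.
Local Open Scope ring_scope.

Definition is_dist (R : realType) (X : finType) (f : X -> R) : Prop :=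
  (forall x, 0 <= f x) /\ \sum_(x : X) f x = 1.

(* Stages are numbered from 0: [h : 'I_H] is the (h+1)-th stage. *)
Record mdp (R : realType) (S A : finType) (H : nat) := Mdp {
  init : S;
  trans : 'I_H -> S -> A -> S -> R;
  trans_dist : forall h s a, is_dist (trans h s a) }.

Record policy (R : realType) (S A : finType) (H : nat) := Policy {
  pol :> 'I_H -> S -> A -> R;
  pol_dist : forall h s, is_dist (pol h s) }.

(* An episode is a pair of a state sequence of length [H.+1] (including the
   state observed after the last action) and an action sequence of length
   [H]. *)
Definition episode (S A : finType) (H : nat) : finType :=
  ({ffun 'I_H.+1 -> S} * {ffun 'I_H -> A})%type.

Section Episode.
Context (S A : finType) (H : nat).
Implicit Types (x : episode S A H) (h : 'I_H).

Definition state_at x h : S := x.1 (widen_ord (leqnSn H) h).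
Definition action_at x h : A := x.2 h.
Definition next_state x h : S := x.1 (lift ord0 h).

Definition visits x h (s : S) (a : A) : bool :=
  (state_at x h == s) && (action_at x h == a).

End Episode.

Section Occupancy.
Context (R : realType) (S A : finType) (H : nat) (M : mdp R S A H).
Implicit Types (pi : policy R S A H) (x : episode S A H).

(* Law of an episode played with [pi]: start in [init M]; at each stage [h]
   draw the action from [pi h s_h], then the next state from
   [trans M h s_h a_h]. *)
Definition episode_prob pi x : R :=
  (x.1 ord0 == init M)%:R *
  \prod_(h < H) (pi h (state_at x h) (action_at x h) *
                 trans M h (state_at x h) (action_at x h) (next_state x h)).

Definition occupancy pi : 'I_H -> S -> A -> R :=
  fun h s a => \sum_(x : episode S A H | visits x h s a) episode_prob pi x.

Definition occupancies : set ('I_H -> S -> A -> R) := range occupancy.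

(* The division is that of extended reals, for which [0^-1 = +oo]: the ratio
   of a positive real by 0 is [+oo]. *)
Definition max_ratio (c rho : 'I_H -> S -> A -> R) : \bar R :=
  (\big[maxe/-oo]_(x : 'I_H * S * A | (0 < c x.1.1 x.1.2 x.2)%R)
     ((c x.1.1 x.1.2 x.2)%:E / (rho x.1.1 x.1.2 x.2)%:E))%E.

Definition phi_star (c : 'I_H -> S -> A -> R) : \bar R :=
  if [exists x : 'I_H * S * A, 0 < c x.1.1 x.1.2 x.2]
  then ereal_inf [set max_ratio c rho | rho in occupancies]
  else 0%E.

End Occupancy.

Section Interaction.
Context (R : realType) (S A : finType) (H : nat) (M : mdp R S A H).
Context (d : measure_display) (T : measurableType d) (P : probability T R).

(* The interaction of an algorithm with [M], realized on [(T, P)].  Episodes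
   are numbered from 0.  [info t] is the sigma-algebra of the information
   available to the learner once [t] episodes have been played; it contains the
   past observations and possibly some internal randomness.  The policy
   [learner_pol t] of the next episode [ep t] is chosen from it, and [ep_law]
   states that, conditionally on [info t], [ep t] is an episode played with that
   policy.  [tau] is the number of episodes played by the algorithm, [None] when
   it never stops; past [tau], the interaction is continued arbitrarily. *)
Record interaction := Interaction {
  info : nat -> set (set T);
  learner_pol : nat -> T -> policy R S A H;
  ep : nat -> T -> episode S A H;
  tau : T -> option nat;
  info_sigma : forall t, sigma_algebra [set: T] (info t);
  info_measurable : forall t, info t `<=` measurable;
  info_incr : forall t, info t `<=` info t.+1;
  ep_observed : forall t x, info t.+1 [set w | ep t w = x];
  learner_pol_chosen : forall t h s a (B : set R),
    measurable B -> info t [set w | B (learner_pol t w h s a)];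
  ep_law : forall t x (E : set T), info t E ->
    P (E `&` [set w | ep t w = x]) =
    (\int[P]_(w in E) (episode_prob M (learner_pol t w) x)%:E)%E;
  tau_stopping : forall t, info t [set w | tau w = Some t] }.

Variable I : interaction.

Definition visit_count (t : nat) (h : 'I_H) (s : S) (a : A) (w : T) : nat :=
  (\sum_(j < t) visits (ep I j w) h s a)%N.

Definition stopping_time (w : T) : \bar R :=
  if tau I w is Some t then (t%:R)%:E else +oo%E.

Definition coverage_correct (c : 'I_H -> S -> A -> R) (delta : R) : Prop :=
  ((1 - delta)%:E <=
   P [set w | exists t, tau I w = Some t /\
        forall h s a, (c h s a <= (visit_count t h s a w)%:R)%R])%E.

End Interaction.

(* Main.v *)
Require Import Defs.
From mathcomp Require Import all_boot all_order all_algebra.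
From mathcomp Require Import all_classical all_reals all_analysis.
From mathcomp Require Import measurable_realfun.
Import Order.TTheory GRing.Theory Num.Theory.
Local Open Scope ring_scope.

Set Implicit Arguments.
Unset Strict Implicit.

(* Truncate at [n] episodes. Let [m h s a] be the expected number of visits
   to [(h, s, a)] and [q] the expected number of episodes among the first
   [min(tau, n)]. Since [tau > t] is known before episode [t] is played, [m] is a
   sum of occupancies of (random) policies weighted by [P(tau > t)]; it satisfies
   the linear flow equations, so [m / q] is the occupancy of a single Markov
   policy. On the event [G n] that the target is covered by some [tau <= n] the
   counts dominate [c], so [m >= c P(G n)] and
   [phi_star c <= max (c q / m) <= q / P(G n) <= E[tau] / P(G n)]. Finally
   [P(G n)] increases to the coverage probability, which is at least
   [1 - delta]. *)

(** * Splitting an episode at its first step *)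

Definition ep_cons (S A : finType) (H : nat) (s : S) (a : A)
    (y : episode S A H) : episode S A H.+1 :=
  ([ffun i => if unlift ord0 i is Some j then y.1 j else s],
   [ffun i => if unlift ord0 i is Some j then y.2 j else a]).

Lemma sum_episodeS (R : realType) (S A : finType) (H : nat)
    (F : episode S A H.+1 -> R) :
  \sum_x F x = \sum_s \sum_a \sum_y F (ep_cons s a y).
Proof.
under [RHS]eq_bigr => s _ do rewrite pair_bigA /=.
rewrite pair_bigA /=.
rewrite (reindex (fun p : S * (A * episode S A H) =>
  ep_cons p.1 p.2.1 p.2.2)) //=.
exists (fun x : episode S A H.+1 => (x.1 ord0, (x.2 ord0,
   ([ffun i => x.1 (lift ord0 i)], [ffun i => x.2 (lift ord0 i)])))).
  move=> [s [a [y z]]] _ /=; rewrite !ffunE !unlift_none.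
  by congr (_, (_, (_, _))); apply/ffunP => i; rewrite !ffunE liftK.
move=> [y z] _ /=; rewrite /ep_cons /=.
by congr (_, _); apply/ffunP => i; rewrite !ffunE /=;
  case: unliftP => [j ->|->]; rewrite ?ffunE.
Qed.

(** [episode_prob] for an arbitrary start and one-step kernel, so that an induction on the horizon
    can drop the first stage. *)
Definition path_weight (R : realType) (S A : finType) (H : nat)
    (w : 'I_H -> S -> A -> S -> R) (s : S) (x : episode S A H) : R :=
  (x.1 ord0 == s)%:R *
  \prod_(h < H) w h (state_at x h) (action_at x h) (next_state x h).

Section Cons.
Context (S A : finType) (H : nat) (s : S) (a : A) (y : episode S A H).

Lemma ep_cons0 : (ep_cons s a y).1 ord0 = s.
Proof. by rewrite ffunE unlift_none. Qed.

Lemma state_at_cons0 : state_at (ep_cons s a y) ord0 = s.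
Proof.
rewrite /state_at (_ : widen_ord _ _ = ord0) ?ep_cons0 //; exact: val_inj.
Qed.

Lemma action_at_cons0 : action_at (ep_cons s a y) ord0 = a.
Proof. by rewrite /action_at ffunE unlift_none. Qed.

Lemma next_state_cons0 : next_state (ep_cons s a y) ord0 = y.1 ord0.
Proof. by rewrite /next_state ffunE liftK. Qed.

Lemma state_at_consS h :
  state_at (ep_cons s a y) (lift ord0 h) = state_at y h.
Proof.
rewrite /state_at (_ : widen_ord _ _ = lift ord0 (widen_ord (leqnSn H) h)).
  by rewrite ffunE liftK.
exact: val_inj.
Qed.

Lemma action_at_consS h :
  action_at (ep_cons s a y) (lift ord0 h) = action_at y h.
Proof. by rewrite /action_at ffunE liftK. Qed.

Lemma next_state_consS h :
  next_state (ep_cons s a y) (lift ord0 h) = next_state y h.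
Proof. by rewrite /next_state ffunE liftK. Qed.

End Cons.

Lemma sum_delta (R : realType) (S : finType) (s : S) (F : S -> R) :
  \sum_x (x == s)%:R * F x = F s.
Proof.
rewrite (bigD1 s) //= eqxx mul1r big1 ?addr0 // => x /negPf ->.
by rewrite mul0r.
Qed.

(** First-step recursion behind both inductions below: the tail is an episode started at [s'] under
    the kernel shifted by one stage. *)
Lemma sum_path_weightS (R : realType) (S A : finType) (H : nat)
    (w : 'I_H.+1 -> S -> A -> S -> R) (s : S) (F : episode S A H.+1 -> R) :
  \sum_x path_weight w s x * F x =
  \sum_a \sum_s' w ord0 s a s' *
    \sum_y path_weight (fun h => w (lift ord0 h)) s' y
           * F (ep_cons s a y).
Proof.
rewrite sum_episodeS.
transitivity (\sum_s0 (s0 == s)%:R * (\sum_a \sum_(y : episode S A H)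
  (w ord0 s0 a (y.1 ord0) *
   \prod_(h < H) w (lift ord0 h) (state_at y h) (action_at y h) (next_state y h))
     * F (ep_cons s0 a y))).
  apply: eq_bigr => s0 _; rewrite mulr_sumr; apply: eq_bigr => a _.
  rewrite mulr_sumr; apply: eq_bigr => y _.
  rewrite /path_weight ep_cons0 -mulrA big_ord_recl.
  rewrite state_at_cons0 action_at_cons0 next_state_cons0; congr (_ * (_ * _ * _)).
  by apply: eq_bigr => h _;
    rewrite state_at_consS action_at_consS next_state_consS.
rewrite sum_delta; apply: eq_bigr => a _.
under [RHS]eq_bigr => s' _ do rewrite mulr_sumr.
rewrite exchange_big /=; apply: eq_bigr => y _.
rewrite [RHS](bigD1 (y.1 ord0)) //= [X in _ = _ + X]big1 => [|s' /negPf sy].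
  by rewrite /path_weight eqxx mul1r addr0 mulrA.
by rewrite /path_weight eq_sym sy !mul0r mulr0.
Qed.

Lemma sum_path_weight (R : realType) (S A : finType) (H : nat)
    (w : 'I_H -> S -> A -> S -> R) (s : S) :
  (forall h s, \sum_a \sum_s' w h s a s' = 1) ->
  \sum_x path_weight w s x = 1.
Proof.
elim: H w s => [|H IH] w s w1.
  (* With horizon 0 an episode is one state and no action, so only the constant sequence [s] has
     nonzero weight. *)
  under eq_bigr => x _ do rewrite /path_weight big_ord0.
  rewrite -(pair_bigA _ (fun (x : {ffun 'I_1 -> S}) (y : {ffun 'I_0 -> A}) =>
    (x ord0 == s)%:R * 1)) /=.
  under eq_bigr => x _ do rewrite sumr_const card_ffun card_ord expn0.
  rewrite (bigD1 [ffun=> s]) //= ffunE eqxx mul1r big1 ?addr0 // => x.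
  apply: contraNeq; rewrite mulr1n mulr1 pnatr_eq0 eqb0 negbK => /eqP xs.
  by apply/eqP/ffunP => i; rewrite ffunE (ord1 i).
rewrite -[RHS](w1 ord0 s) -[LHS](eq_bigr _ (fun x _ => mulr1 _)).
rewrite sum_path_weightS; apply: eq_bigr => a _; apply: eq_bigr => s' _.
under eq_bigr => y _ do rewrite mulr1.
by rewrite IH ?mulr1.
Qed.

(* Tower property: the last step is averaged out given the state at stage [h]. *)
Lemma path_weight_tower (R : realType) (S A : finType) (H : nat)
    (w : 'I_H -> S -> A -> S -> R) (s : S) (h : 'I_H) (g : S -> A -> S -> R) :
  (forall h s, \sum_a \sum_s' w h s a s' = 1) ->
  \sum_x path_weight w s x
    * g (state_at x h) (action_at x h) (next_state x h) =
  \sum_x path_weight w s x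
    * \sum_a \sum_s' w h (state_at x h) a s' * g (state_at x h) a s'.
Proof.
elim: H w s h => [|H IH] w s h w1; first by case: h.
rewrite !sum_path_weightS.
have [->|[k ->]] : h = ord0 \/ exists k, h = lift ord0 k.
  by case: (unliftP ord0 h) => [k ->|->]; [right; exists k|left].
(* First stage: on the right only the initial state is read, so the tail sums out with total weight
   1. *)
- under [RHS]eq_bigr => a _ do under eq_bigr => s' _ do
    (under eq_bigr => y _ do rewrite state_at_cons0;
     rewrite -mulr_suml sum_path_weight// mul1r).
  under [RHS]eq_bigr => a _ do rewrite -mulr_suml.
  rewrite -mulr_suml w1 mul1r; apply: eq_bigr => a _; apply: eq_bigr => s' _.
  congr (_ * _).
  (* The mass 1 of the tails is put back to compare term by term: a tail [y] has weight 0 unless it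
     starts at [s'], the next state read by [g]. *)
  rewrite -[RHS]mul1r -(sum_path_weight (w := fun h => w (lift ord0 h)) s')//.
  rewrite mulr_suml; apply: eq_bigr => y _.
  rewrite state_at_cons0 action_at_cons0 next_state_cons0 /path_weight.
  by have [->//|_] := eqVneq (y.1 ord0) s'; rewrite !mul0r.
- apply: eq_bigr => a _; apply: eq_bigr => s' _; congr (_ * _).
  under eq_bigr => y _ do
    rewrite state_at_consS action_at_consS next_state_consS.
  by rewrite IH//; apply: eq_bigr => y _; rewrite state_at_consS.
Qed.

(** * Occupancies and the flow equations *)

Section Flow.
Context (R : realType) (S A : finType) (H : nat) (M : mdp R S A H).

Lemma sum_pol_trans (pi : policy R S A H) h s :
  \sum_a \sum_s' pi h s a * trans M h s a s' = 1.
Proof.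
under eq_bigr => a _ do rewrite -mulr_sumr (trans_dist M h s a).2 mulr1.
exact: (pol_dist pi h s).2.
Qed.

Lemma episode_prob_ge0 (pi : policy R S A H) x : 0 <= episode_prob M pi x.
Proof.
apply: mulr_ge0 => //; apply: prodr_ge0 => h _.
by apply: mulr_ge0; [exact: (pol_dist pi h _).1|exact: (trans_dist M h _ _).1].
Qed.

Lemma occupancyE (pi : policy R S A H) h s a :
  occupancy M pi h s a =
  \sum_x episode_prob M pi x * ((state_at x h == s) && (action_at x h == a))%:R.
Proof.
rewrite /occupancy big_mkcond; apply: eq_bigr => x _.
by rewrite /visits; case: (_ && _); rewrite ?mulr1 ?mulr0.
Qed.

Lemma occupancy_ge0 (pi : policy R S A H) h s a : 0 <= occupancy M pi h s a.
Proof. by apply: sumr_ge0 => x _; exact: episode_prob_ge0. Qed.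

Lemma sum_action_occupancy (pi : policy R S A H) h s :
  \sum_a occupancy M pi h s a =
  \sum_x episode_prob M pi x * (state_at x h == s)%:R.
Proof.
under eq_bigr => a _ do rewrite occupancyE.
rewrite exchange_big; apply: eq_bigr => x _ /=; rewrite -mulr_sumr; congr (_ * _).
rewrite -[RHS](sum_delta (action_at x h) (fun=> _)); apply: eq_bigr => a _.
by rewrite -natrM mulnb andbC (eq_sym a).
Qed.

Lemma occupancy_tower (pi : policy R S A H) h (g : S -> A -> S -> R) :
  \sum_x episode_prob M pi x
    * g (state_at x h) (action_at x h) (next_state x h) =
  \sum_x episode_prob M pi x * \sum_a \sum_s'
    pi h (state_at x h) a * trans M h (state_at x h) a s' * g (state_at x h) a s'.
Proof.
exact: (path_weight_tower (w := fun h s a s' => pi h s a * trans M h s a s')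
  (init M) h g (sum_pol_trans pi)).
Qed.

(** The tower property for the indicator of a visit, which ignores the next state: given the state,
    the action follows [pi h s]. *)
Lemma occupancy_pol (pi : policy R S A H) h s a :
  occupancy M pi h s a = (\sum_b occupancy M pi h s b) * pi h s a.
Proof.
rewrite sum_action_occupancy occupancyE.
rewrite (occupancy_tower pi h (fun x y _ => ((x == s) && (y == a))%:R)).
rewrite mulr_suml; apply: eq_bigr => x _; rewrite -mulrA; congr (_ * _).
have [->|_] := eqVneq (state_at x h) s; last first.
  by rewrite mul0r big1// => b _; rewrite big1// => s' _; rewrite mulr0.
rewrite mul1r -[RHS](sum_delta a (pi h s)); apply: eq_bigr => b _ /=.
by rewrite -mulr_suml -mulr_sumr (trans_dist M h s b).2 mulr1 mulrC.
Qed.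

(* For [q = 1] these affine equations cut out the occupancies among the
   nonnegative arrays; a general total mass [q] makes them stable under sums. *)
Definition flow (rho : 'I_H -> S -> A -> R) (q : R) : Prop :=
  (forall (h : 'I_H) s, h = 0%N :> nat ->
     \sum_a rho h s a = (s == init M)%:R * q) /\
  (forall (h k : 'I_H) s', k = h.+1 :> nat ->
     \sum_a rho k s' a = \sum_s \sum_a trans M h s a s' * rho h s a).

Lemma occupancy_flow (pi : policy R S A H) : flow (occupancy M pi) 1.
Proof.
split=> [h s h0|h k s' kh].
  rewrite sum_action_occupancy mulr1.
  transitivity (\sum_x episode_prob M pi x * (s == init M)%:R).
    apply: eq_bigr => x _; rewrite /state_at (_ : widen_ord _ _ = ord0).
      rewrite /episode_prob; have [->|_] := eqVneq (x.1 ord0) (init M).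
        by rewrite eq_sym.
      by rewrite !mul0r.
    exact: val_inj.
  rewrite -mulr_suml.
  rewrite (sum_path_weight (w := fun h s a s' => pi h s a * trans M h s a s'))
    ?mul1r//; exact: sum_pol_trans.
rewrite sum_action_occupancy.
(* The state at stage [k] is the next state of stage [h], to which the tower property applies. *)
transitivity (\sum_x episode_prob M pi x * (next_state x h == s')%:R).
  apply: eq_bigr => x _; rewrite /state_at /next_state.
  by rewrite (_ : widen_ord _ k = lift ord0 h)//; apply: val_inj.
rewrite (occupancy_tower pi h (fun _ _ y => (y == s')%:R)).
under [RHS]eq_bigr => s _ do under eq_bigr => a _ do
  rewrite occupancy_pol mulrCA.
under [RHS]eq_bigr => s _ do rewrite -mulr_sumr sum_action_occupancy mulr_suml.
rewrite [RHS]exchange_big /=; apply: eq_bigr => x _.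
under [RHS]eq_bigr => s _ do rewrite -mulrA eq_sym.
rewrite -mulr_sumr sum_delta; congr (_ * _); apply: eq_bigr => a _.
rewrite -[RHS](sum_delta s' (fun s' => trans M h (state_at x h) a s' * _)).
by apply: eq_bigr => t _; rewrite mulrC (mulrC (pi _ _ _)).
Qed.

(** Normalizing [rho] by its state marginals yields a policy, and the flow equations determine these
    marginals stage by stage. *)
Lemma flow_occupancy (a0 : A) (rho : 'I_H -> S -> A -> R) :
  (forall h s a, 0 <= rho h s a) -> flow rho 1 -> occupancies M rho.
Proof.
move=> rho0 [rho_init rho_next].
(* [a0] is an arbitrary action for states of zero mass; nonnegativity makes [rho] vanish there, so
   [fE] holds in that case too. *)
pose f h s a : R := if \sum_b rho h s b == 0 then (a == a0)%:R
  else rho h s a / \sum_b rho h s b.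
have fP h s : is_dist (f h s).
  rewrite /f; have [_|r0] := eqVneq; split=> [a|] //.
  - by rewrite -[RHS](sum_delta a0 (fun=> 1)); apply: eq_bigr => a _; rewrite mulr1.
  - by rewrite divr_ge0// sumr_ge0.
  - by rewrite -mulr_suml divff.
have fE h s a : (\sum_b rho h s b) * f h s a = rho h s a.
  rewrite /f; have [r0|r0] := eqVneq; last by rewrite mulrC divfK.
  apply/esym/eqP; rewrite r0 mul0r eq_le rho0 andbT -r0.
  by rewrite (bigD1 a)//= lerDl sumr_ge0.
exists (Policy fP) => //.
apply/funext => h; apply/funext => s; apply/funext => a.
have [occ_init occ_next] := occupancy_flow (Policy fP).
(* Both arrays are a state marginal times [f]; the marginals agree at the first stage by the initial
   equation and later by induction. *)
move En : (val h) => n; elim: n h En s a => [|n IH] h hn s a.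
  by rewrite occupancy_pol occ_init// -(rho_init h s hn) fE.
have nH : (n < H)%N by rewrite (leq_trans _ (ltn_ord h))// hn.
rewrite occupancy_pol (occ_next (Ordinal nH))// -[RHS]fE.
rewrite (rho_next (Ordinal nH))//=; congr (_ * _).
by apply: eq_bigr => t _; apply: eq_bigr => b _; rewrite IH.
Qed.

End Flow.

(** Linearity of the flow equations replaces an explicit mixture of policies: weighted occupancies
    are added here and renormalized by [flow_scale]. *)
Lemma flow_sum (R : realType) (S A : finType) (H : nat) (M : mdp R S A H)
    (n : nat) (rho : 'I_n -> 'I_H -> S -> A -> R) (q : 'I_n -> R) :
  (forall t, flow M (rho t) (q t)) ->
  flow M (fun h s a => \sum_t rho t h s a) (\sum_t q t).
Proof.
move=> fl; split=> [h s h0|h k s' kh].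
  rewrite exchange_big mulr_sumr; apply: eq_bigr => t _; exact: (fl t).1.
rewrite exchange_big /=.
under eq_bigr => t _ do rewrite ((fl t).2 h k)//.
rewrite exchange_big; apply: eq_bigr => s _ /=.
by rewrite exchange_big; apply: eq_bigr => a _; rewrite mulr_sumr.
Qed.

Lemma flow_scale (R : realType) (S A : finType) (H : nat) (M : mdp R S A H)
    (rho : 'I_H -> S -> A -> R) (q k : R) :
  flow M rho q -> flow M (fun h s a => rho h s a * k) (q * k).
Proof.
move=> [fl0 flS]; split=> [h s h0|h h' s' hh']; rewrite -mulr_suml.
  by rewrite fl0// mulrA.
rewrite (flS h)// mulr_suml; apply: eq_bigr => s _.
by rewrite mulr_suml; apply: eq_bigr => a _; rewrite mulrA.
Qed.

Local Open Scope classical_set_scope.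

(** * Expectations of finite sums *)

Lemma integral_lincomb (R : realType) (d : measure_display)
    (T : measurableType d) (P : probability T R) (E : set T) (J : finType)
    (k : J -> R) (f : J -> T -> R) :
  measurable E -> (forall j, 0 <= k j) -> (forall j w, 0 <= f j w) ->
  (forall j, measurable_fun [set: T] (f j)) ->
  (\int[P]_(w in E) (\sum_j k j * f j w)%:E =
   \sum_j (k j)%:E * \int[P]_(w in E) (f j w)%:E)%E.
Proof.
move=> mE k0 f0 mf; under eq_integral => w _ do rewrite -sumEFin.
have mfE j : measurable_fun E (EFin \o f j).
  by apply/measurable_EFinP; apply: measurable_funTS.
rewrite ge0_integral_sum//.
- apply: eq_bigr => j _.
  under eq_integral => w _ do rewrite EFinM.
  have f0E w : E w -> (0 <= (f j w)%:E)%E by rewrite lee_fin.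
  exact: (ge0_integralZl_EFin P mE f0E (mfE j) (k0 j)).
- by move=> j; apply/measurable_EFinP; apply: measurable_funM => //; apply: measurable_funTS.
- by move=> j w _; rewrite lee_fin mulr_ge0.
Qed.

Lemma integral_sum_indic (R : realType) (d : measure_display)
    (T : measurableType d) (P : probability T R) (n : nat) (F : nat -> set T) :
  (forall t, measurable (F t)) ->
  (\int[P]_w (\sum_(t < n) \1_(F t) w)%:E = (\sum_(t < n) fine (P (F t)))%:E)%E.
Proof.
move=> mF; under eq_integral => w _ do
  under eq_bigr => t _ do rewrite -[\1_ _ _]mul1r.
rewrite (integral_lincomb P (k := fun=> 1) (f := fun (t : 'I_n) w => \1_(F t) w))//.
  rewrite -sumEFin; apply: eq_bigr => t _ /=.
  by rewrite mul1e integral_indic// setIT fineK// fin_num_measure.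
by move=> t; exact: measurable_indic.
Qed.

(** * Measurability along the interaction and the law of visits *)

Section Interaction.
Context (R : realType) (S A : finType) (H : nat) (M : mdp R S A H).
Context (d : measure_display) (T : measurableType d) (P : probability T R).
Context (I : interaction M P).

(** The event [tau > t]: the algorithm plays episode [t], numbered from 0. Never stopping is
    included. *)
Definition running (t : nat) : set T :=
  [set w | forall j, (j <= t)%N -> tau I w <> Some j].

Definition visited (t : nat) h s a : set T := [set w | visits (ep I t w) h s a].

Lemma in_visited (t : nat) h s a w :
  (w \in visited t h s a) = visits (ep I t w) h s a.
Proof. by apply/idP/idP => [/set_mem//|v]; rewrite mem_set. Qed.

Lemma info_mono (t u : nat) : (t <= u)%N -> info I t `<=` info I u.
Proof.
move=> tu; rewrite -(subnKC tu); elim: (u - t)%N => [|k IH]; first by rewrite addn0.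
by rewrite addnS => E /IH; exact: info_incr.
Qed.

Lemma info_running (t : nat) : info I t (running t).
Proof.
have [i0 iD iU] := info_sigma I t.
(* Only stops at times up to [t] matter, all known by then; padding with [set0] gives the countable
   union that a sigma-algebra admits. *)
rewrite (_ : running t = setT `\`
    \bigcup_j (if (j <= t)%N then [set w | tau I w = Some j] else set0)).
  apply/iD/iU => j; case: ifP => // jt.
  by apply: (info_mono jt); exact: tau_stopping.
apply/seteqP; split=> w /=.
  move=> r; split=> // -[j _ /=]; case: ifP => // jt; exact: r.
by move=> [_ n] j jt wj; apply: n; exists j => //=; rewrite jt.
Qed.

Lemma measurable_running (t : nat) : measurable (running t).
Proof. exact/(info_measurable (i := I))/info_running. Qed.

Lemma measurable_tau (t : nat) : measurable [set w | tau I w = Some t].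
Proof. exact/(info_measurable (i := I))/tau_stopping. Qed.

Lemma measurable_ep (t : nat) (x : episode S A H) :
  measurable [set w | ep I t w = x].
Proof. exact/(info_measurable (i := I))/ep_observed. Qed.

Lemma measurable_visited (t : nat) h s a : measurable (visited t h s a).
Proof.
rewrite (_ : visited t h s a =
    \bigcup_(x in [set x | visits x h s a]) [set w | ep I t w = x]).
  by apply: fin_bigcup_measurable => [|x _]; [exact: finite_finset|exact: measurable_ep].
by apply/seteqP; split=> [w v|w [x /= + wx]]; [exists (ep I t w)|rewrite -wx].
Qed.

Lemma measurable_learner_pol (t : nat) h s a :
  measurable_fun [set: T] (fun w => learner_pol I t w h s a).
Proof.
move=> _ B mB; rewrite setTI.
exact/(info_measurable (i := I))/(learner_pol_chosen I t h s a mB).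
Qed.

Lemma measurable_episode_prob (t : nat) (x : episode S A H) :
  measurable_fun [set: T] (fun w => episode_prob M (learner_pol I t w) x).
Proof.
apply: measurable_funM => //; apply: measurable_prod => h _.
by apply: measurable_funM => //; exact: measurable_learner_pol.
Qed.

Lemma measurable_occupancy (t : nat) h s a :
  measurable_fun [set: T] (fun w => occupancy M (learner_pol I t w) h s a).
Proof.
rewrite /occupancy; under eq_fun do rewrite -big_filter.
by apply: measurable_sum => x; exact: measurable_episode_prob.
Qed.

(** Obtained by summing [ep_law] over the finitely many episodes through [(h, s, a)]; it applies
    because [E] is known before episode [t]. *)
Lemma visited_prob (t : nat) (E : set T) h s a : info I t E ->
  P (E `&` visited t h s a) =
  (\int[P]_(w in E) (occupancy M (learner_pol I t w) h s a)%:E)%E.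
Proof.
move=> iE; have mE := info_measurable iE.
transitivity (\int[P]_(w in E)
    (\sum_x (visits x h s a)%:R * \1_[set w | ep I t w = x] w)%:E)%E.
  rewrite setIC -integral_indic//; last exact: measurable_visited.
  apply: eq_integral => w _; congr (_%:E); rewrite (bigD1 (ep I t w))//= big1.
    by rewrite !indicE addr0 in_visited mem_set// mulr1.
  by move=> x /eqP xw; rewrite indicE memNset ?mulr0// => /esym.
rewrite integral_lincomb//; last first.
  by move=> x; apply: measurable_indic; exact: measurable_ep.
transitivity (\int[P]_(w in E) (\sum_x (visits x h s a)%:R *
    episode_prob M (learner_pol I t w) x)%:E)%E; last first.
  apply: eq_integral => w _; congr (_%:E); rewrite /occupancy [RHS]big_mkcond.
  by apply: eq_bigr => x _; case: visits; rewrite ?mul1r ?mul0r.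
rewrite integral_lincomb//.
- apply: eq_bigr => x _; rewrite integral_indic//; last exact: measurable_ep.
  by congr (_ * _)%E; rewrite setIC; exact: ep_law.
- by move=> x w; exact: episode_prob_ge0.
- exact: measurable_episode_prob.
Qed.

(** The flow equations hold for the occupancy of the chosen policy at every [w]. Being linear with
    deterministic coefficients, they survive integration over [E], and the mass 1 becomes [P E]. *)
Lemma visited_flow (t : nat) (E : set T) : info I t E ->
  flow M (fun h s a => fine (P (E `&` visited t h s a))) (fine (P E)).
Proof.
move=> iE; have mE := info_measurable iE.
have mE' h s a : measurable (E `&` visited t h s a).
  by apply: measurableI => //; exact: measurable_visited.
have rhoE h s a : (fine (P (E `&` visited t h s a)))%:E =
    (\int[P]_(w in E) (occupancy M (learner_pol I t w) h s a)%:E)%E.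
  by rewrite fineK ?visited_prob// -visited_prob// fin_num_measure.
have margE h s : (\sum_a fine (P (E `&` visited t h s a)))%:E =
    (\int[P]_(w in E) (\sum_a occupancy M (learner_pol I t w) h s a)%:E)%E.
  under [RHS]eq_integral => w _ do under eq_bigr => a _ do rewrite -[occupancy _ _ _ _ _]mul1r.
  rewrite (integral_lincomb P (k := fun=> 1))//.
  - by rewrite -sumEFin; apply: eq_bigr => a _; rewrite rhoE mul1e.
  - by move=> a w; exact: occupancy_ge0.
  - by move=> a; exact: measurable_occupancy.
split=> [h s h0|h k s' kh]; apply: EFin_inj; rewrite margE.
  under eq_integral => w _ do rewrite (occupancy_flow M _).1//.
  by rewrite integral_cst// mulr1 EFinM fineK// fin_num_measure.
under eq_integral => w _ do rewrite ((occupancy_flow M _).2 h)// pair_bigA /=.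
rewrite (integral_lincomb P (k := fun p : S * A => trans M h p.1 p.2 s')
  (f := fun p w => occupancy M (learner_pol I t w) h p.1 p.2))//.
- rewrite pair_bigA -sumEFin; apply: eq_bigr => p _.
  by rewrite -rhoE EFinM.
- by move=> p; exact: (trans_dist M h _ _).1.
- by move=> p w; exact: occupancy_ge0.
- by move=> p; exact: measurable_occupancy.
Qed.

(** * Expected duration and coverage within [n] episodes *)

Lemma stopping_time_ge0 w : (0 <= stopping_time I w)%E.
Proof. by rewrite /stopping_time; case: tau => // t; rewrite lee_fin. Qed.

Lemma measurable_stopping_time : measurable_fun [set: T] (stopping_time I).
Proof.
move=> _ Y mY; rewrite setTI.
(* Only countably many values occur: the preimage is a union of levels of [tau], plus the
   never-stopping event when [+oo] is in [Y]. *)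
rewrite (_ : _ @^-1` _ =
    \bigcup_t (if (t%:R)%:E \in Y then [set w | tau I w = Some t] else set0) `|`
    (if +oo%E \in Y then ~` \bigcup_t [set w | tau I w = Some t] else set0)).
  apply: measurableU.
    by apply: bigcup_measurable => t _; case: ifP => // _; exact: measurable_tau.
  case: ifP => // _; apply: measurableC.
  by apply: bigcup_measurable => t _; exact: measurable_tau.
apply/seteqP; split=> w; rewrite /preimage /stopping_time /=.
  case tw: (tau I w) => [t|] Yw.
    by left; exists t => //; rewrite mem_set.
  by right; rewrite mem_set//= => -[t _ /=]; rewrite tw.
case=> [[t _]|].
  by case: ifP => // /set_mem Yt /= ->.
case: ifP => // /set_mem Yoo /=; case tw: (tau I w) => [t|//].
by move=> n; exfalso; apply: n; exists t.
Qed.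

(** The indicators of [running t] for [t < n] add up to [min(tau, n)], which is at most [tau]. *)
Lemma running_prob_le (n : nat) :
  ((\sum_(t < n) fine (P (running t)))%:E <= \int[P]_w stopping_time I w)%E.
Proof.
rewrite -integral_sum_indic; last exact: measurable_running.
apply: ge0_le_integral => //.
- by move=> w _; rewrite lee_fin sumr_ge0.
- apply/measurable_EFinP; apply: measurable_sum => t.
  by apply: measurable_indic; exact: measurable_running.
- exact: measurable_stopping_time.
move=> w _; rewrite /stopping_time; case tw: (tau I w) => [k|]; last by rewrite leey.
rewrite lee_fin.
apply: (@le_trans _ _ (\sum_(t < n | (t < k)%N) 1)).
  rewrite [leRHS]big_mkcond; apply: ler_sum => t _; rewrite indicE.
  case: ltnP => kt; first by case: (_ \in _).
  by rewrite memNset// => /(_ k kt).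
have [kn|/ltnW nk] := leqP k n.
  by rewrite -(big_ord_widen n (fun=> 1) kn) sumr_const card_ord.
by rewrite sumr_const ler_nat (leq_trans (max_card _))// card_ord.
Qed.

(** The bound [n] keeps visit counts within finitely many episodes; these events increase with [n]
    to the coverage event. *)
Definition covered (c : 'I_H -> S -> A -> R) (n : nat) : set T :=
  [set w | exists t, [/\ (t <= n)%N, tau I w = Some t &
     forall h s a, c h s a <= (visit_count I t h s a w)%:R]].

Lemma visit_countE (t : nat) h s a w :
  (visit_count I t h s a w)%:R = \sum_(j < t) \1_(visited j h s a) w :> R.
Proof.
rewrite /visit_count natr_sum; apply: eq_bigr => j _; by rewrite indicE in_visited.
Qed.

Lemma measurable_covered c (n : nat) : measurable (covered c n).
Proof.
rewrite (_ : covered c n = \bigcup_(t in [set t | (t <= n)%N])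
    ([set w | tau I w = Some t] `&` \bigcap_(x in [set: 'I_H * S * A])
      ((fun w => \sum_(j < t) \1_(visited j x.1.1 x.1.2 x.2) w) @^-1`
         `[c x.1.1 x.1.2 x.2, +oo[))).
  apply: bigcup_measurable => t _; apply: measurableI; first exact: measurable_tau.
  apply: fin_bigcap_measurable; first exact: finite_finset.
  move=> x _; rewrite -[_ @^-1` _]setTI.
  suff: measurable_fun [set: T] (fun w => \sum_(j < t) \1_(visited j x.1.1 x.1.2 x.2) w : R).
    by apply.
  by apply: measurable_sum => j; apply: measurable_indic; exact: measurable_visited.
apply/seteqP; split=> w /=.
  move=> [t [tn tw cw]]; exists t => //; split=> // -[[h s] a] _ /=.
  by rewrite in_itv /= andbT -visit_countE.
move=> [t tn [tw cw]]; exists t; split=> // h s a.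
by have := cw ((h, s), a) Logic.I; rewrite /= in_itv /= andbT -visit_countE.
Qed.

(** Integrates a pointwise bound: on [covered c n] the target is at most the count up to [tau <= n],
    and every visit counted there happens while the algorithm is running. *)
Lemma visited_prob_ge c (n : nat) h s a : 0 <= c h s a ->
  c h s a * fine (P (covered c n)) <=
  \sum_(t < n) fine (P (running t `&` visited t h s a)).
Proof.
move=> c0; have mF t : measurable (running t `&` visited t h s a).
  by apply: measurableI; [exact: measurable_running|exact: measurable_visited].
have mG := measurable_covered c n.
rewrite -lee_fin -(integral_sum_indic P n mF).
have -> : (c h s a * fine (P (covered c n)))%:E =
    (\int[P]_w ((c h s a)%:E * (\1_(covered c n) w)%:E))%E.
  rewrite ge0_integralZl_EFin//; last exact/measurable_EFinP/measurable_indic.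
  by rewrite integral_indic// setIT EFinM fineK// fin_num_measure.
apply: ge0_le_integral => //.
- by move=> w _; rewrite -EFinM lee_fin mulr_ge0.
- by apply: measurable_funeM; exact/measurable_EFinP/measurable_indic.
- by apply/measurable_EFinP; apply: measurable_sum => t; exact: measurable_indic.
move=> w _; rewrite -EFinM lee_fin indicE.
have [/set_mem [t [tn tw cw]]|_] := boolP (w \in covered c n); last first.
  by rewrite mulr0 sumr_ge0.
rewrite mulr1 (le_trans (cw h s a))// visit_countE.
rewrite (big_ord_widen n (fun j => \1_(visited j h s a) w : R) tn).
rewrite big_mkcond; apply: ler_sum => j _; case: ltnP => // jt.
rewrite !indicE ler_nat; have [/set_mem v|//] := boolP (w \in visited j h s a).
by rewrite mem_set//; split=> // i ij; rewrite tw => -[ti]; move: jt; rewrite ltnNge ti ij.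
Qed.

Lemma phi_star_le c (n : nat) (x : 'I_H * S * A) :
  0 < c x.1.1 x.1.2 x.2 -> 0 < fine (P (covered c n)) ->
  (phi_star M c <=
   ((\sum_(t < n) fine (P (running t))) / fine (P (covered c n)))%:E)%E.
Proof.
move=> cx G0; set q := \sum_(t < n) _; set G := fine _ in G0 *.
pose m h s a : R := \sum_(t < n) fine (P (running t `&` visited t h s a)).
have mG h s a : 0 < c h s a -> c h s a * G <= m h s a.
  by move=> c0; apply: visited_prob_ge; exact: ltW.
(* A visit while running is in particular an episode played, so [q] is at least [m] at [x], which is
   positive. *)
have q0 : 0 < q.
  apply: (@lt_le_trans _ _ (m x.1.1 x.1.2 x.2)).
    by apply: lt_le_trans (mG _ _ _ cx); rewrite mulr_gt0.
  have mr := measurable_running.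
  apply: ler_sum => t _; apply: fine_le; rewrite ?fin_num_measure//.
    by apply: measurableI => //; exact: measurable_visited.
  apply: le_measure; rewrite ?inE//.
  by apply: measurableI => //; exact: measurable_visited.
have occ : occupancies M (fun h s a => m h s a * q^-1).
  (* The action of [x] serves as the default action of the policy. *)
  apply: (flow_occupancy x.2) => [h s a|].
    by rewrite mulr_ge0 ?invr_ge0 ?(ltW q0)// sumr_ge0// => t _; rewrite fine_ge0.
  rewrite -(divff (lt0r_neq0 q0)); apply: flow_scale.
  by apply: flow_sum => t; apply: visited_flow; exact: info_running.
rewrite /phi_star ifT; last by apply/existsP; exists x.
apply: ge_ereal_inf; exists (max_ratio c (fun h s a => m h s a * q^-1)).
  by exists (fun h s a => m h s a * q^-1).
apply: bigmax_le => [|y cy]; first exact: leNye.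
have m0 : 0 < m y.1.1 y.1.2 y.2.
  by apply: lt_le_trans (mG _ _ _ cy); rewrite mulr_gt0.
(* The denominator is positive, so the extended ratio is finite and the bound reduces to [mG]. *)
rewrite inver gt_eqF ?divr_gt0// -EFinM lee_fin invf_div.
by rewrite mulrCA ler_pM2l// ler_pdivrMr// mulrC ler_pdivlMr// mG.
Qed.

End Interaction.

(** * Passage to the limit in [n] *)

Unset Implicit Arguments.
Set Strict Implicit.
Local Close Scope classical_set_scope.

Theorem theorem2 (R : realType) (S A : finType) (H : nat) (M : mdp R S A H)
    (d : measure_display) (T : measurableType d) (P : probability T R)
    (I : interaction M P) (c : 'I_H -> S -> A -> R) (delta : R) :
  0 < delta < 1 ->
  coverage_correct I c delta ->
  ((1 - delta)%:E * phi_star M c <= \int[P]_w stopping_time I w)%E.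
Proof.
move=> /andP[_ d1] cov; have d0 : 0 < 1 - delta by rewrite subr_gt0.
have tau0 : (0 <= \int[P]_w stopping_time I w)%E.
  by apply: integral_ge0 => w _; exact: stopping_time_ge0.
have [/existsP[x cx]|noX] :=
  boolP [exists x : 'I_H * S * A, 0 < c x.1.1 x.1.2 x.2]; last first.
  by rewrite /phi_star (negPf noX) mule0.
have mG n := measurable_covered I c n.
pose g n : R := fine (P (covered I c n)).
have gE n : (g n)%:E = P (covered I c n) by rewrite fineK// fin_num_measure.
(* Continuity from below, phrased as: a bound valid for every [covered c n] also bounds
   [1 - delta]. *)
have G_le b : (forall n, P (covered I c n) <= b%:E)%E -> 1 - delta <= b.
  move=> Gb; rewrite -lee_fin; apply: le_trans cov _.
  rewrite (_ : [set _ | _]%classic = (\bigcup_n covered I c n)%classic).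
    apply: (cvge_to_le (nondecreasing_cvg_mu mG _ _)).
    - exact: bigcup_measurable.
    - move=> m n mn; apply/subsetPset => w [t [tm tw cw]].
      by exists t; split => //; exact: leq_trans mn.
    - exact: nearW.
  apply/seteqP; split=> w /=; first by case=> t [tw cw]; exists t => //; exists t.
  by case=> n _ [t [_ tw cw]]; exists t.
have [n gn0] : exists n, 0 < g n.
  apply: contrapT => /forallNP gn; move: d0; rewrite ltNge => /negP; apply.
  by apply: G_le => n; rewrite -gE lee_fin leNgt; apply/negP/gn.
have phi_le m : 0 < g m ->
    (phi_star M c <= \int[P]_w stopping_time I w * (g m)^-1%:E)%E.
  move=> gm0; apply: le_trans (phi_star_le cx gm0) _.
  by rewrite EFinM lee_wpmul2r ?running_prob_le// lee_fin invr_ge0 ltW.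
(* Extended values are cleared first: an infinite expectation is trivial, and [phi_le n gn0]
   excludes [phi_star M c = +oo] when it is finite. *)
move: tau0 phi_le; case: (\int[P]_w stopping_time I w)%E => [e|_ _|//]; last by rewrite leey.
rewrite lee_fin => e0 phi_le.
move: phi_le (phi_le n gn0).
case: (phi_star M c) => [f phi_le _|//|_ _]; last first.
  by rewrite gt0_muleNy ?lte_fin// leNye.
rewrite -EFinM lee_fin.
have [f0|f0] := leP f 0; first by rewrite (le_trans _ e0)// mulr_ge0_le0// ltW.
(* With [f > 0] the goal becomes [1 - delta <= e / f], so it suffices to bound each [g m] by
   [e / f], which is [phi_le m] rearranged. *)
rewrite -ler_pdivlMr//; apply: G_le => m; rewrite -gE lee_fin.
have [gm0|gm0] := ltP 0 (g m); last by rewrite (le_trans gm0)// divr_ge0// ltW.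
move: (phi_le m gm0); rewrite -EFinM lee_fin ler_pdivlMr//.
by rewrite ler_pdivlMr// mulrC.
Qed.
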